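(* Let $\mathfrak g$ be a nilpotent Lie algebra with nilindex $p$, and let $\mathcal X:=\mathfrak g^n$, $\mathcal W:=\mathfrak g^r$ with $n,r\ge 1$. Consider the dynamics $X^+=f(X,W)$, where $f:\mathcal X\times\mathcal W\to\mathcal X$ is a Lie function with linear part $A:\mathcal X\to\mathcal X$ in the state, such that: (1) $f$ belongs to class-$\mathcal A$; (2) the origin of $\mathcal X$ is the unique equilibrium, i.e. for $X\in\mathcal X$, $f(X,W)=X$ for all $W\in\mathcal W$ if and only if $X=0$; (3) $f\big((\mathfrak g^{(i)})^n,\mathcal W\big)\subseteq(\mathfrak g^{(i)})^n$ for every ideal $\mathfrak g^{(i)}$ of the lower central series of $\mathfrak g$. If there exist $\beta\ge 0$ and $s\ge 1$ such that $\|W[k]\|\le\beta s^k$ for all $k\ge 0$, and $\rho(A)<s^{\frac{p(1-p)}{2}}$, then the origin of $\mathcal X$ is semiglobally exponentially stable.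
   Context: All vector spaces are finite dimensional over $\mathbb F\in\{\mathbb R,\mathbb C\}$. $\mathfrak g$ is a (matrix) Lie algebra with a norm $\|\cdot\|$, and $\mu\in[0,2]$ is a constant with $\|[X,Y]\|\le\mu\|X\|\|Y\|$ for all $X,Y\in\mathfrak g$. Cartesian powers carry the sum norm. $\rho$ denotes spectral radius. Lower central series: $\mathfrak g^{(1)}:=\mathfrak g$, $\mathfrak g^{(i+1)}:=[\mathfrak g^{(i)},\mathfrak g]$. $\mathfrak g$ is nilpotent if $\mathfrak g^{(p+1)}=0$ for some finite $p$; the smallest such $p$ is its nilindex. System: $X^+=f(X,W)$ means $X[k+1]=f(X[k],W[k])$, $k\ge0$, with state $X=(X_1,\dots,X_n)\in\mathcal X$ and exogenous signal $W=(W_1,\dots,W_r)\in\mathcal W$ that does not depend on $X$. A word $\omega$ of length $|\omega|$ is a nested bracket $[Y_{\omega_1},[Y_{\omega_2},[\dots,Y_{\omega_{|\omega|}}]\cdots]$ with letters $Y_{\omega_j}$ in $\widetilde X\cup\widetilde W$, where $\widetilde X=\{X_1,\dots,X_n\}$ and $\widetilde W=\{W_1,\dots,W_r\}$. A Lie function is a function whose components are (possibly infinite) linear combinations of words in its arguments. It belongs to class-$\mathcal A$ if, for each component with scalar coefficients $c_\omega$, there is a neighbourhood of the origin on which $\sum_\omega\mu^{|\omega|-1}|c_\omega|\|Y_{\omega_1}\|\cdots\|Y_{\omega_{|\omega|}}\|<\infty$. Under the stated hypotheses the dynamics are written as $f(X,W)=AX+\sum_\omega c_\omega\otimes\omega$,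 where $A:\mathcal X\to\mathcal X$ is linear, the sum is over words of length at least $2$, every word has at least one letter in $\widetilde X$, and $c_\omega\in\mathbb F^n$ (with $\mathfrak g^n\cong\mathbb F^n\otimes\mathfrak g$). Semiglobal exponential stability of the origin: for all $M>0$ there exist $\alpha\ge0$, $\lambda<1$ such that if $\|X[0]\|\le M$ then $\|X[k]\|\le\alpha\lambda^k\|X[0]\|$ for all $k\ge0$. *)

(* Defs.v *)
From HB Require Import structures.
From mathcomp Require Import all_boot all_order all_algebra.
From mathcomp Require Import finmap complex.
From mathcomp Require Import boolp classical_sets reals ereal esum exp.

Set Implicit Arguments.
Unset Strict Implicit.
Unset Printing Implicit Defensive.

Import Order.TTheory GRing.Theory Num.Theory.
Import ComplexField.
Local Open Scope ring_scope.

Variant scalar_kind := RealScalars | ComplexScalars.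

Definition scalars (R : realType) (k : scalar_kind) : numFieldType :=
  match k with
  | RealScalars => (R : numFieldType)
  | ComplexScalars => (R[i]%C : numFieldType)
  end.

Definition to_complex (R : realType) (k : scalar_kind) :
    scalars R k -> R[i]%C :=
  match k return scalars R k -> R[i]%C with
  | RealScalars => fun x : R => x%:C%C
  | ComplexScalars => fun z => z
  end.

(* R-valued modulus; the norm of R[i] as a numFieldType is R[i]-valued *)
Definition modulus (R : realType) (k : scalar_kind) (x : scalars R k) : R :=
  Normc.normc (to_complex x).

(* eigenvalues are taken in R[i] also when the scalars are real; the set of
   moduli is empty exactly for V = 0, in which case the value is sup set0 = 0 *)
Definition spectral_radius (R : realType) (k : scalar_kind)
    (V : vectType (scalars R k)) (A : 'End(V)) : R :=
  sup [set x : R | exists z : R[i]%C,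
    eigenvalue (map_mx (@to_complex R k)
      (passmx.mxof (vbasis fullv) (vbasis fullv) A)) z
    /\ x = Normc.normc z]%classic.

Record is_norm (R : realType) (k : scalar_kind) (V : lmodType (scalars R k))
    (nrm : V -> R) : Prop := IsNorm {
  norm_triangle : forall x y, nrm (x + y) <= nrm x + nrm y ;
  norm_scale : forall a x, nrm (a *: x) = modulus a * nrm x ;
  norm_definite : forall x, nrm x = 0 -> x = 0 }.

Definition sum_norm (R : realType) (V : Type) (nrm : V -> R) {m : nat}
    (x : {ffun 'I_m -> V}) : R :=
  \sum_(i < m) nrm (x i).

Record is_lie_bracket (F : fieldType) (g : lmodType F) (br : g -> g -> g) :
    Prop := IsLieBracket {
  bracket_linearl : forall y, linear (br^~ y) ;
  bracket_linearr : forall x, linear (br x) ;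
  bracket_alternating : forall x, br x x = 0 ;
  bracket_jacobi : forall x y z,
    br x (br y z) + br y (br z x) + br z (br x y) = 0 }.

Section LowerCentralSeries.
Context (F : fieldType) (g : vectType F) (br : g -> g -> g).

(* same device as prodv: brackets of basis vectors span all brackets *)
Definition bracketv (U V : {vspace g}) : {vspace g} :=
  <<[seq br u v | u <- vbasis U, v <- vbasis V]>>%VS.

Lemma bracketv_subP (U V Z : {vspace g}) : is_lie_bracket br ->
  reflect {in U & V, forall u v, br u v \in Z} (bracketv U V <= Z)%VS.
Proof.
move=> hbr; apply: (iffP span_subvP) => [sub u v uU vV | sub w].
  pose lin y := GRing.isLinear.Build F g g *:%R (br^~ y)
    (bracket_linearl hbr y).
  pose linr x := GRing.isLinear.Build F g g *:%R (br x)
    (bracket_linearr hbr x).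
  pose brl y : {linear g -> g} := HB.pack (br^~ y) (lin y).
  pose brr x : {linear g -> g} := HB.pack (br x) (linr x).
  rewrite (coord_vbasis uU) [X in X \in Z](linear_sum (brl v)).
  apply: memv_suml => i _; rewrite linearZ memvZ//= (coord_vbasis vV).
  rewrite [X in X \in Z](linear_sum (brr _)).
  apply: memv_suml => j _; rewrite linearZ memvZ//=.
  by apply: sub; apply: allpairs_f; rewrite mem_nth ?size_tuple.
by case/allpairsP=> -[u v] /= [/vbasis_mem uU /vbasis_mem vV ->]; exact: sub.
Qed.

(* indexed from 1: lcs 1 is the whole algebra (and so is the unused lcs 0) *)
Definition lcs (i : nat) : {vspace g} :=
  iter i.-1 (fun U => bracketv U fullv) fullv.

Definition has_nilindex (p : nat) : Prop :=
  lcs p.+1 = 0%VS /\ forall q, (q < p)%N -> lcs q.+1 <> 0%VS.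

End LowerCentralSeries.

(* a letter is a component of the state (inl) or of the exogenous signal (inr) *)
Definition letter (n r : nat) : Type := ('I_n + 'I_r)%type.
Definition word (n r : nat) : Type := seq ('I_n + 'I_r).

(* The linear part A of a Lie function absorbs its one-letter words in the
   state; the rest of the series runs over all the other (nonempty) words,
   including those without any state letter. *)
Definition series_word (n r : nat) (w : word n r) : bool :=
  match w with
  | [::] | [:: inl _] => false
  | _ => true
  end.

Section LieFunctions.
Context (R : realType) (k : scalar_kind) (g : vectType (scalars R k)).
Context (br : g -> g -> g) (nrm : g -> R) (n r : nat).
Implicit Types (x : {ffun 'I_n -> g}) (w : {ffun 'I_r -> g}).

Definition letter_val x w (a : letter n r) : g :=
  match a with inl i => x i | inr j => w j end.

Fixpoint word_val x w (o : word n r) : g :=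
  match o with
  | [::] => 0
  | [:: a] => letter_val x w a
  | a :: o' => br (letter_val x w a) (word_val x w o')
  end.

(* unconditional convergence of a family indexed by words *)
Definition word_sum (u : word n r -> g) (l : g) : Prop :=
  forall eps : R, 0 < eps -> exists S0 : {fset word n r},
    forall S : {fset word n r}, (S0 `<=` S)%fset ->
      nrm (l - \sum_(o <- S | series_word o) u o) < eps.

Definition lie_function
    (f : {ffun 'I_n -> g} -> {ffun 'I_r -> g} -> {ffun 'I_n -> g})
    (A : 'End({ffun 'I_n -> g})) (c : word n r -> 'I_n -> scalars R k) : Prop :=
  forall x w i,
    word_sum (fun o => c o i *: word_val x w o) (f x w i - A x i).

Definition class_A (mu : R) (c : word n r -> 'I_n -> scalars R k) : Prop :=
  forall i, exists2 delta : R, 0 < delta & forall x w,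
    sum_norm nrm x + sum_norm nrm w < delta ->
    (\esum_(o in [set o | series_word o]%classic)
       (mu ^+ (size o).-1 * modulus (c o i)
          * \prod_(a <- o) nrm (letter_val x w a))%:E < +oo)%E.

End LieFunctions.

Definition semiglobally_exp_stable (R : realType) (X : Type) (nrm : X -> R)
    (F : nat -> X -> X) : Prop :=
  forall M : R, 0 < M -> exists alpha lambda : R,
    [/\ 0 <= alpha, lambda < 1 &
      forall x : nat -> X, (forall t, x t.+1 = F t (x t)) -> nrm (x 0%N) <= M ->
        forall t, nrm (x t) <= alpha * lambda ^+ t * nrm (x 0%N)].

(* Main.v *)
From HB Require Import structures.
Require Import Defs.
From mathcomp Require Import all_boot all_order all_algebra.
From mathcomp Require Import finmap complex.
From mathcomp Require Import boolp classical_sets reals exp.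
From mathcomp Require Import topology normedtype derive.
From mathcomp Require Import ring.

(** In a nilpotent algebra every word longer than the nilindex p vanishes, so
    the dynamics are polynomial.  Since 0 is an equilibrium, f 0 w = 0 for all
    w, so the words without a state letter contribute nothing, and
    f x w = A x + N x w where N is a finite combination of mixed words: length
    at least 2, at least one state letter (lie_function_expansion).

    Consider the Picard iteration y_0 = 0 and, for each i, the linear recursion
      y_(i+1) (t+1) = A (y_(i+1) t) + N_(i+1) (y_i t) (W t),
      y_(i+1) 0 = x 0,
    where N_m keeps the mixed words of length at most m.  By induction on i,
    the difference x - y_i has its components in the term i+1 of the lower
    central series.  Indeed a mixed word has length at least 2, so moving its
    state letters by elements of the term i moves its value by an element of
    the term i+1; a word of length greater than i already lies in the term
    i+1; and A preserves every term because f does.  At i = p the term is 0,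
    so x = y_p.

    It remains to bound the growth of the y_i (picard_approximation).  A word of
    N_(i+1) has length at most i+1, hence at most i letters from W, each of
    size O(s^t); one of its state letters is kept as the decaying factor, and
    all the other ones are merely bounded, by a constant that depends on the
    bound M on the initial state.  So if y_i t = O(theta^t), then the forcing
    term of y_(i+1) is O((theta s^i)^t).  As theta s^i exceeds the spectral
    radius of A, the solution y_(i+1) of the linear recursion is of the same
    order (forced_linear_recursion).  Starting from some lambda greater than
    the spectral radius, the rate of y_p is
      lambda s^(0 + 1 + ... + (p-1)) = lambda s^(p(p-1)/2),
    and the hypothesis on the spectral radius is what lets lambda be chosen so
    that this is less than 1.

    The linear estimate comes from the Cayley-Hamilton theorem, peeling off the
    roots of the characteristic polynomial one at a time.  It is proved for
    complex row vectors and transferred to an arbitrary norm through the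
    equivalence of norms in finite dimension. *)

Set Implicit Arguments.
Unset Strict Implicit.
Unset Printing Implicit Defensive.

Import Order.TTheory GRing.Theory Num.Theory.
Local Open Scope ring_scope.

(** * Norms on finite-dimensional spaces *)

Section RealNormEquivalence.
Import numFieldNormedType.Exports.
Local Open Scope classical_set_scope.

(** A norm is Lipschitz, hence continuous, and so attains a positive minimum on
    the compact unit sphere of the sup norm. *)
Lemma real_norm_dominates_entries (R : realType) d (N : 'rV[R]_d -> R) :
  (forall u v, N (u + v) <= N u + N v) ->
  (forall a v, N (a *: v) = `|a| * N v) ->
  (forall v, N v = 0 -> v = 0) ->
  exists2 K, 0 <= K & forall (v : 'rV_d) i, `|v 0 i| <= K * N v.
Proof.
move=> ND NZ Ndef.
have N0 : N 0 = 0 by rewrite -(scale0r 0) NZ normr0 mul0r.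
have NN v : N (- v) = N v by rewrite -scaleN1r NZ normrN1 mul1r.
have Nge0 v : 0 <= N v.
  by have := ND v (- v); rewrite subrr N0 NN -mulr2n pmulrn_lge0.
have entry_le (v : 'rV[R]_d) i : `|v 0 i| <= `|v|.
  rewrite [leRHS]/Num.norm /= mx_normrE; apply/bigmax_geP; right => /=.
  by exists (0, i).
pose L := \sum_j N (delta_mx 0 j).
have N_le v : N v <= L * `|v|.
  rewrite {1}(row_sum_delta v) mulr_suml.
  have : N (\sum_(j < d) v 0 j *: delta_mx 0 j)
         <= \sum_(j < d) N (v 0 j *: delta_mx 0 j).
    elim/big_ind2 : _ => //= [|x a y b xa yb]; first by rewrite N0.
    by rewrite (le_trans (ND _ _))// lerD.
  move=> /le_trans; apply; apply: ler_sum => j _.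
  by rewrite NZ mulrC ler_wpM2l.
have L0 : 0 <= L by apply: sumr_ge0.
have Ncont : continuous N.
  move=> v; apply/(cvgrPdist_lt (FF := nbhs_filter v)) => e e0; near=> u.
  have NB x y : N x - N y <= N (x - y).
    by rewrite lerBlDr (le_trans _ (ND _ _))// subrK.
  apply: (@le_lt_trans _ _ (N (v - u))).
    by rewrite ler_norml NB andbT lerNl opprB (le_trans (NB _ _))// -NN opprB.
  apply: (le_lt_trans (N_le _)).
  have uv : `|v - u| < e / (L + 1).
    near: u; apply/nbhs_ballP; exists (e / (L + 1)) => /=.
      by rewrite divr_gt0// ltr_wpDl.
    by move=> x; rewrite -ball_normE.
  rewrite (@le_lt_trans _ _ ((L + 1) * `|v - u|))//.
    by rewrite ler_wpM2r// lerDl.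
  by rewrite mulrC -ltr_pdivlMr// ltr_wpDl.
pose S := [set v : 'rV[R]_d | `|v| = 1].
have [S0|/set0P/negP/negPn/eqP S0] := pselect (S !=set0); last first.
  exists 0 => // v i; rewrite mul0r.
  suff -> : v = 0 by rewrite mxE normr0.
  apply: contrapT => /eqP v0.
  suff : S (`|v|^-1 *: v) by rewrite S0.
  by rewrite /S/= normrZ normfV normr_id mulVf// normr_eq0.
have Scompact : compact S.
  apply: bounded_closed_compact.
    by exists 1; split=> // M M1 v /= ->; exact: ltW.
  have -> : S = (fun v : 'rV[R]_d => `|v|) @^-1` [set 1] by [].
  by apply: closed_comp => [v _|]; [exact: norm_continuous|exact: closed_eq].
have [v0 /set_mem Sv0 v0min] := EVT_min_rV S0 Scompact
  (continuous_subspaceT Ncont).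
have Nv0 : 0 < N v0.
  rewrite lt_neqAle Nge0 andbT eq_sym; apply/eqP => /Ndef v00.
  by move: Sv0; rewrite /S/= v00 normr0 => /eqP; rewrite eq_sym oner_eq0.
exists (N v0)^-1 => [|v i]; first by rewrite invr_ge0.
rewrite (le_trans (entry_le v i))// mulrC ler_pdivlMr//.
have [->|vn0] := eqVneq v 0; first by rewrite normr0 mul0r.
have nv0 : 0 < `|v| by rewrite normr_gt0.
have := v0min (`|v|^-1 *: v); rewrite inE => /(_ _)/=.
rewrite NZ normfV normr_id ler_pdivlMl//; apply.
by rewrite /S/= normrZ normfV normr_id mulVf// gt_eqF.
Unshelve. all: by end_near. Qed.

End RealNormEquivalence.

Section ScalarModulus.
Context {R : realType} {k : scalar_kind}.
Local Notation F := (scalars R k).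

Lemma to_complex_is_zmod_morphism : zmod_morphism (@to_complex R k).
Proof. by case: k => //= x y; rewrite rmorphB. Qed.

Lemma to_complex_is_monoid_morphism : monoid_morphism (@to_complex R k).
Proof. by case: k; split => //= x y; rewrite rmorphM. Qed.

HB.instance Definition _ := GRing.isZmodMorphism.Build F R[i]%C
  (@to_complex R k) to_complex_is_zmod_morphism.
HB.instance Definition _ := GRing.isMonoidMorphism.Build F R[i]%C
  (@to_complex R k) to_complex_is_monoid_morphism.

End ScalarModulus.

Section Norms.
Context {R : realType} {k : scalar_kind}.
Local Notation F := (scalars R k).

Lemma normc_ge0 (z : R[i]%C) : 0 <= Normc.normc z.
Proof. by case: z => a b; exact: sqrtr_ge0. Qed.

Lemma normc_real (a : R) : Normc.normc (a%:C)%C = `|a|.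
Proof. by rewrite /Normc.normc/= expr0n addr0 sqrtr_sqr. Qed.

Lemma normc_le_Re_Im (z : R[i]%C) :
  Normc.normc z <= `|complex.Re z| + `|complex.Im z|.
Proof.
have <- : Normc.normc (0 +i* complex.Im z)%C = `|complex.Im z|.
  by rewrite /Normc.normc/= expr0n add0r sqrtr_sqr.
rewrite -normc_real; apply: le_trans (le_normcD _ _).
by case: z => a b; rewrite /GRing.add/= addr0 add0r.
Qed.

Lemma modulus_ge0 (a : F) : 0 <= modulus a.
Proof. exact: normc_ge0. Qed.

Lemma modulus0 : modulus (0 : F) = 0.
Proof. by rewrite /modulus rmorph0 Normc.normc0. Qed.

Lemma modulusN1 : modulus (-1 : F) = 1.
Proof. by rewrite /modulus rmorphN1 normcN Normc.normc1. Qed.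

Context {V : lmodType F} {nrm : V -> R} (hN : is_norm nrm).

Lemma nrm0 : nrm 0 = 0.
Proof. by rewrite -(scale0r 0) (norm_scale hN) modulus0 mul0r. Qed.

Lemma nrmN v : nrm (- v) = nrm v.
Proof. by rewrite -scaleN1r (norm_scale hN) modulusN1 mul1r. Qed.

Lemma nrm_ge0 v : 0 <= nrm v.
Proof.
have := norm_triangle hN v (- v).
by rewrite subrr nrm0 nrmN -mulr2n pmulrn_lge0.
Qed.

Lemma nrm_sum (I : Type) (s : seq I) (P : pred I) (u : I -> V) :
  nrm (\sum_(i <- s | P i) u i) <= \sum_(i <- s | P i) nrm (u i).
Proof.
elim/big_ind2 : _ => //= [|x a y b xa yb]; first by rewrite nrm0.
by rewrite (le_trans (norm_triangle hN _ _))// lerD.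
Qed.

Lemma sum_norm_is_norm n :
  is_norm (@sum_norm R V nrm n : {ffun 'I_n -> V} -> R).
Proof.
split=> [x y|a x|x].
- rewrite /sum_norm -big_split/=; apply: ler_sum => i _.
  by rewrite ffunE (norm_triangle hN).
- rewrite /sum_norm mulr_sumr; apply: eq_bigr => i _.
  by rewrite ffunE (norm_scale hN).
- move=> /eqP; rewrite psumr_eq0; last by move=> i _; exact: nrm_ge0.
  move=> /allP x0; apply/ffunP => i; rewrite ffunE; apply: (norm_definite hN).
  by apply/eqP/x0; rewrite mem_index_enum.
Qed.

End Norms.

(** Complex coordinates are handled by counting their real and imaginary parts
    as separate real coordinates, which doubles the dimension. *)
Lemma norm_dominates_coordinates (R : realType) (k : scalar_kind)
    (V : vectType (scalars R k)) (nrm : V -> R) : is_norm nrm ->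
  exists2 K, 0 <= K &
    forall v i, modulus (coord (vbasis fullv) i v) <= K * nrm v.
Proof.
move=> hN; pose b : (\dim {:V}).-tuple V := vbasis fullv.
have bfree : free b := basis_free (vbasisP _).
have coordK v : \sum_i coord b i v *: b`_i = v.
  by rewrite -coord_vbasis// memvf.
case: k V nrm hN @b bfree coordK => V nrm hN b bfree coordK.
  pose L (r : 'rV[R]_(\dim {:V})) : V :=
    \sum_i (r 0 i : scalars R RealScalars) *: b`_i.
  have [|||K K0 KP] := @real_norm_dominates_entries R _ (nrm \o L).
  - move=> u v; rewrite /= (le_trans _ (norm_triangle hN _ _))//.
    rewrite -big_split/=.
    rewrite [L _](_ : _ = \sum_i (u 0 i *: b`_i + v 0 i *: b`_i))//.
    by apply: eq_bigr => i _; rewrite mxE scalerDl.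
  - move=> a v; rewrite /= -(normc_real a) -(norm_scale hN).
    congr nrm; rewrite scaler_sumr; apply: eq_bigr => i _.
    by rewrite mxE scalerA.
  - move=> v /(norm_definite hN); move/freeP: bfree => /[apply] v0.
    by apply/rowP => i; rewrite mxE v0.
  exists K => // v i; rewrite [modulus _](normc_real (coord b i v : R)).
  have := KP (\row_i coord b i v) i; rewrite /= mxE => /le_trans; apply.
  rewrite ler_wpM2l// -[in leRHS](coordK v) le_eqVlt; apply/orP; left.
  by apply/eqP; congr nrm; apply: eq_bigr => j _; rewrite mxE.
pose z (r : 'rV[R]_(\dim {:V} + \dim {:V})) i : scalars R ComplexScalars :=
  (lsubmx r 0 i +i* rsubmx r 0 i)%C.
pose L r : V := \sum_i z r i *: b`_i.
have [|||K K0 KP] := @real_norm_dominates_entries R _ (nrm \o L).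
- move=> u v; rewrite /= (le_trans _ (norm_triangle hN _ _))//.
  rewrite -big_split/=.
  rewrite [L _](_ : _ = \sum_i (z u i *: b`_i + z v i *: b`_i))//.
  by apply: eq_bigr => i _; rewrite -scalerDl /z !mxE.
- move=> a v; rewrite /= -(normc_real a).
  rewrite -[Normc.normc _]/(modulus (a%:C%C : scalars R ComplexScalars)).
  rewrite -(norm_scale hN); congr nrm; rewrite scaler_sumr.
  apply: eq_bigr => i _; rewrite scalerA; congr (_ *: _).
  by rewrite /z !mxE /GRing.mul/= !mul0r addr0 subr0.
- move=> v /(norm_definite hN); move/freeP: bfree => /[apply] v0.
  apply/rowP => i; rewrite mxE -[v]hsubmxK mxE.
  by case: split => j; have [] := v0 j.
exists (K + K) => [|v i]; first exact: addr_ge0.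
pose r := row_mx (\row_i complex.Re (coord b i v))
  (\row_i complex.Im (coord b i v)).
have Lr : L r = v.
  rewrite -[RHS](coordK v); apply: eq_bigr => j _; congr (_ *: _).
  by rewrite /z row_mxKl row_mxKr !mxE; case: coord.
rewrite (le_trans (normc_le_Re_Im _))// mulrDl lerD//.
- by have := KP r (lshift _ i); rewrite row_mxEl mxE /= Lr.
- by have := KP r (rshift _ i); rewrite row_mxEr mxE /= Lr.
Qed.

(** * Linear recursions with an exponentially bounded forcing term *)

Section ForcedLinearRecursion.
Context {R : realType}.
Local Notation C := (R[i]%C).
Local Notation normc := Normc.normc.

Definition l1norm d (u : 'rV[C]_d) : R := \sum_j normc (u 0 j).

Lemma l1norm_ge0 d (u : 'rV[C]_d) : 0 <= l1norm u.
Proof. by apply: sumr_ge0 => j _; exact: normc_ge0. Qed.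

Lemma l1normD d (u v : 'rV[C]_d) : l1norm (u + v) <= l1norm u + l1norm v.
Proof.
by rewrite /l1norm -big_split; apply: ler_sum => j _; rewrite mxE le_normcD.
Qed.

Lemma l1normZ d z (u : 'rV[C]_d) : l1norm (z *: u) = normc z * l1norm u.
Proof.
by rewrite /l1norm mulr_sumr; apply: eq_bigr => j _; rewrite mxE Normc.normcM.
Qed.

Lemma normc_sum (I : Type) (s : seq I) (u : I -> C) :
  normc (\sum_(i <- s) u i) <= \sum_(i <- s) normc (u i).
Proof.
elim/big_ind2 : _ => // [|x a y b xa yb]; first by rewrite Normc.normc0.
by rewrite (le_trans (le_normcD _ _))// lerD.
Qed.

Lemma l1norm_mulmx d (B : 'M[C]_d) :
  exists2 K, 0 <= K & forall u, l1norm (u *m B) <= K * l1norm u.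
Proof.
exists (\sum_j \sum_i normc (B i j)) => [|u].
  by do 2![apply: sumr_ge0 => ? _]; exact: normc_ge0.
rewrite /l1norm mulr_suml; apply: ler_sum => j _; rewrite mxE.
rewrite (le_trans (normc_sum _ _))// mulr_suml; apply: ler_sum => i _.
rewrite Normc.normcM mulrC ler_wpM2l ?normc_ge0// (bigD1 i)//= lerDl.
by apply: sumr_ge0 => ? _; exact: normc_ge0.
Qed.

(** The constant solves the induction step: with c = x 0 + E / (theta - a),
    one has a c + E <= theta c. *)
Lemma scalar_forced_recursion (a theta E : R) (x : nat -> R) :
  0 <= a -> a < theta -> 0 <= E -> 0 <= x 0%N ->
  (forall t, x t.+1 <= a * x t + E * theta ^+ t) ->
  forall t, x t <= (x 0%N + E / (theta - a)) * theta ^+ t.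
Proof.
move=> a0 atheta E0 x0 xS; have ta0 : 0 < theta - a by rewrite subr_gt0.
have th0 : 0 <= theta := ltW (le_lt_trans a0 atheta).
elim=> [|t IHt]; first by rewrite mulr1 lerDl divr_ge0// ltW.
rewrite (le_trans (xS t))// exprS.
apply: (@le_trans _ _ ((a * (x 0%N + E / (theta - a)) + E) * theta ^+ t)).
  by rewrite [leRHS]mulrDl lerD2r -mulrA ler_wpM2l.
rewrite mulrA ler_wpM2r ?exprn_ge0//.
rewrite -lerBrDl [_ * theta]mulrC -mulrBl mulrDr mulrCA divff ?gt_eqF// mulr1.
by rewrite lerDr mulr_ge0// ltW.
Qed.

(** Induction on the roots.  If z is the first one, v t = u t (B - z) solves a
    recursion of the same form and is annihilated by the remaining factors,
    while u (t+1) = z u t + v t + h t is a first-order recursion with forcing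
    term v t + h t.  Working directly with the forced recursion, for theta
    greater than all the roots, avoids any resonance. *)
Lemma forced_recursion_annihilated d (B : 'M[C]_d.+1) (theta : R) (rs : seq C) :
  all (fun z => normc z < theta) rs ->
  exists2 K, 0 <= K & forall (u h : nat -> 'rV[C]_d.+1) H,
    (forall t, u t.+1 = u t *m B + h t) ->
    l1norm (u 0%N) <= H -> (forall t, l1norm (h t) <= H * theta ^+ t) ->
    (forall t, u t *m horner_mx B (\prod_(z <- rs) ('X - z%:P)) = 0) ->
    forall t, l1norm (u t) <= K * H * theta ^+ t.
Proof.
elim: rs => [_|z rs IHrs /= /andP[ztheta /IHrs[K K0 KP]]].
  exists 0 => // u h H _ _ _ u0 t; rewrite mul0r mul0r.
  have := u0 t; rewrite big_nil rmorph1 mulmx1 => ->.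
  by rewrite /l1norm big1// => j _; rewrite mxE Normc.normc0.
have [L L0 LP] := l1norm_mulmx (B - z%:M).
have theta0 : 0 <= theta := ltW (le_lt_trans (normc_ge0 _) ztheta).
exists (1 + (K * L + 1) / (theta - normc z)).
  rewrite addr_ge0// divr_ge0 ?subr_ge0 ?(ltW ztheta)//.
  by rewrite addr_ge0// mulr_ge0.
move=> u h H uS u0H hH uP t.
have H0 : 0 <= H := le_trans (l1norm_ge0 _) u0H.
pose v t := u t *m (B - z%:M).
have vE s : l1norm (v s) <= K * (L * H) * theta ^+ s.
  apply: (KP v (fun s => h s *m (B - z%:M))) => [r||r|r].
  - rewrite /v uS mulmxDl; congr (_ + _).
    by rewrite -!mulmxA mulmxBl mulmxBr scalar_mxC.
  - exact: le_trans (LP _) (ler_wpM2l L0 u0H).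
  - by apply: le_trans (LP _) _; rewrite -mulrA ler_wpM2l.
  - rewrite /v -(uP r) big_cons rmorphM/= rmorphB/= horner_mx_X horner_mx_C.
    by rewrite mulmxA.
have uS' s : l1norm (u s.+1) <=
    normc z * l1norm (u s) + (K * L + 1) * H * theta ^+ s.
  have -> : u s.+1 = z *: u s + (v s + h s).
    rewrite uS /v mulmxBr mul_mx_scalar addrA addrC [_ - _]addrC.
    by rewrite addNKr addrC.
  rewrite (le_trans (l1normD _ _))// l1normZ lerD2l (le_trans (l1normD _ _))//.
  by rewrite mulrDl mulrDl mul1r lerD// -(mulrA K).
have E0 : 0 <= (K * L + 1) * H by rewrite mulr_ge0// addr_ge0// mulr_ge0.
have := scalar_forced_recursion (normc_ge0 z) ztheta E0 (l1norm_ge0 _) uS' t.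
move=> /le_trans; apply; rewrite ler_wpM2r ?exprn_ge0//.
by rewrite [leRHS]mulrDl mul1r [X in _ <= _ + X]mulrAC lerD2r.
Qed.

Lemma forced_recursion_rV d (B : 'M[C]_d) (theta : R) :
  0 <= theta -> (forall z, eigenvalue B z -> normc z < theta) ->
  exists2 K, 0 <= K & forall (u h : nat -> 'rV[C]_d) H,
    (forall t, u t.+1 = u t *m B + h t) ->
    (forall t, l1norm (h t) <= H * theta ^+ t) ->
    forall t, l1norm (u t) <= K * (l1norm (u 0%N) + H) * theta ^+ t.
Proof.
move=> theta0; case: d B => [|d] B eigB.
  by exists 0 => // u h H _ _ t; rewrite /l1norm big_ord0 !mul0r.
have [rs] := closed_field_poly_normal (char_poly B).
rewrite (eqP (char_poly_monic B)) scale1r => charB.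
have [|K K0 KP] := @forced_recursion_annihilated _ B theta rs.
  apply/allP => z zrs; apply: eigB; rewrite eigenvalue_root_char charB.
  by rewrite root_prod_XsubC.
exists K => // u h H uS hH t.
have H0 : 0 <= H.
  by have := le_trans (l1norm_ge0 _) (hH 0%N); rewrite expr0 mulr1.
apply: (KP u h) => // [|s|s]; first by rewrite lerDl.
  by rewrite (le_trans (hH s))// ler_wpM2r ?exprn_ge0// lerDr l1norm_ge0.
by rewrite -charB Cayley_Hamilton mulmx0.
Qed.

(** The supremum is that of a bounded set, because the eigenvalues are the
    finitely many roots of the characteristic polynomial. *)
Lemma eigenvalue_le_sup d (B : 'M[C]_d) z : eigenvalue B z ->
  normc z <= sup [set x | exists z, eigenvalue B z /\ x = normc z]%classic.
Proof.
move=> Bz; apply: ub_le_sup; last by exists z.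
have [rs] := closed_field_poly_normal (char_poly B).
rewrite (eqP (char_poly_monic B)) scale1r => charB.
exists (\sum_(y <- rs) normc y) => _ [y [+ ->]].
rewrite eigenvalue_root_char charB root_prod_XsubC => yrs.
rewrite (big_rem y)//= lerDl; apply: sumr_ge0 => ? _; exact: normc_ge0.
Qed.

End ForcedLinearRecursion.

(** Discrete variation of constants: above the spectral radius, the solution
    decays or grows no faster than its forcing term.  The constant K is
    uniform in the initial value and in the forcing term, as semiglobal
    stability requires. *)
Lemma forced_linear_recursion (R : realType) (k : scalar_kind)
    (V : vectType (scalars R k)) (nrm : V -> R) (A : 'End(V)) (theta : R) :
  is_norm nrm -> 0 <= theta -> spectral_radius A < theta ->
  exists2 K, 0 <= K & forall (y h : nat -> V) H,
    (forall t, y t.+1 = A (y t) + h t) ->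
    (forall t, nrm (h t) <= H * theta ^+ t) ->
    forall t, nrm (y t) <= K * (nrm (y 0%N) + H) * theta ^+ t.
Proof.
move=> hN theta0 rhoA; pose b := vbasis {:V}.
have bP : basis_of {:V} b := vbasisP _.
pose B := map_mx (@to_complex R k) (passmx.mxof b b A).
have [|K K0 KP] := @forced_recursion_rV _ _ B theta theta0.
  by move=> z Bz; apply: le_lt_trans rhoA; exact: eigenvalue_le_sup.
have [L L0 LP] := norm_dominates_coordinates hN.
pose crd v := map_mx (@to_complex R k) (passmx.rVof b v).
pose d := (\dim {:V})%:R : R.
have crd_le v : l1norm (crd v) <= d * L * nrm v.
  rewrite /l1norm.
  have : \sum_j Normc.normc (crd v 0 j) <= \sum_(j < \dim {:V}) L * nrm v.
    by apply: ler_sum => j _; rewrite !mxE; exact: LP.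
  by rewrite sumr_const card_ord -mulr_natl mulrA.
pose M := \sum_(j < \dim {:V}) nrm b`_j.
have M0 : 0 <= M by apply: sumr_ge0 => j _; exact: nrm_ge0.
have le_crd v : nrm v <= M * l1norm (crd v).
  rewrite {1}(coord_vbasis (memvf v)) (le_trans (nrm_sum hN _ _ _))//.
  rewrite mulr_suml; apply: ler_sum => j _.
  rewrite (norm_scale hN) mulrC ler_wpM2l ?nrm_ge0//.
  rewrite /l1norm (bigD1 j)//= !mxE lerDl; apply: sumr_ge0 => ? _.
  exact: normc_ge0.
have dL0 : 0 <= d * L by rewrite mulr_ge0// ler0n.
exists (M * K * (d * L)) => [|y h H yS hH t]; first by rewrite !mulr_ge0.
rewrite (le_trans (le_crd _))//.
have crdE u v : crd (A u + v) = crd u *m B + crd v.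
  by rewrite /crd /B -map_mxM -passmx.rVof_app// -map_mxD; congr map_mx;
    apply/rowP => j; rewrite !mxE linearD.
have KPt : l1norm (crd (y t)) <=
    K * (l1norm (crd (y 0%N)) + d * L * H) * theta ^+ t.
  apply: (KP (crd \o y) (crd \o h)) => r; first by rewrite /= yS crdE.
  by rewrite /= (le_trans (crd_le _))// -(mulrA (d * L)) ler_wpM2l.
rewrite -!(mulrA M) ler_wpM2l// (le_trans KPt)// ler_wpM2r ?exprn_ge0//.
by rewrite -(mulrA K) ler_wpM2l// mulrDr lerD2r.
Qed.

(** * Lower central series *)

Section LowerCentralSeriesTheory.
Context {F : fieldType} {g : vectType F} {br : g -> g -> g}.
Hypothesis hbr : is_lie_bracket br.

Lemma brDl u v w : br (u + v) w = br u w + br v w.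
Proof. by have := bracket_linearl hbr w 1 u v; rewrite /= !scale1r. Qed.

Lemma brDr u v w : br w (u + v) = br w u + br w v.
Proof. by have := bracket_linearr hbr w 1 u v; rewrite /= !scale1r. Qed.

Lemma br0l w : br 0 w = 0.
Proof. by apply: (addIr (br 0 w)); rewrite add0r -brDl addr0. Qed.

Lemma br0r w : br w 0 = 0.
Proof. by apply: (addIr (br w 0)); rewrite add0r -brDr addr0. Qed.

Lemma brBl u v w : br (u - v) w = br u w - br v w.
Proof. by apply: (addIr (br v w)); rewrite -brDl !subrK. Qed.

Lemma brBr u v w : br w (u - v) = br w u - br w v.
Proof. by apply: (addIr (br w v)); rewrite -brDr !subrK. Qed.

Lemma br_sub u u' v v' : br u v - br u' v' = br (u - u') v + br u' (v - v').
Proof. by rewrite brBl brBr addrA subrK. Qed.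

Lemma br_antisym u v : br u v = - br v u.
Proof.
apply/eqP; rewrite -addr_eq0; apply/eqP.
have := bracket_alternating hbr (u + v); rewrite brDl !brDr.
by rewrite !(bracket_alternating hbr) add0r addr0.
Qed.

Lemma lcs_br i u v : (0 < i)%N -> u \in lcs br i -> br u v \in lcs br i.+1.
Proof.
case: i => // i _ ui; have /bracketv_subP := subvv (lcs br i.+2).
by move=> /(_ hbr); apply => //; rewrite memvf.
Qed.

Lemma lcs_brr i u v : (0 < i)%N -> u \in lcs br i -> br v u \in lcs br i.+1.
Proof. by move=> i0 ui; rewrite br_antisym memvN lcs_br. Qed.

Lemma lcs_succ_sub i : (lcs br i.+1 <= lcs br i)%VS.
Proof.
elim: i => [|[|i] IHi]; [exact: subvf|exact: subvf|].
by apply/bracketv_subP => // u v /(subvP IHi) ui _; exact: lcs_br.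
Qed.

Lemma lcs_antitone i j : (i <= j)%N -> (lcs br j <= lcs br i)%VS.
Proof.
move=> /subnK <-; elim: (j - i)%N => [|d IHd]; first exact: subvv.
exact: subv_trans (lcs_succ_sub _) IHd.
Qed.

End LowerCentralSeriesTheory.

(** * Words *)

Section Words.
Context {n r : nat}.

Definition state_word (o : word n r) : bool :=
  has (fun a => if a is inl _ then true else false) o.

Definition mixed_word (o : word n r) : bool := (1 < size o)%N && state_word o.

Definition short_words (m : nat) : {fset word n r} :=
  [fset o in flatten
     [seq [seq tval t | t <- enum {: d.-tuple ('I_n + 'I_r)%type}]
        | d <- iota 0 m.+1]]%fset.

Lemma mem_short_words m o : (o \in short_words m) = (size o <= m)%N.
Proof.
rewrite in_fset; apply/flatten_mapP/idP => [[d + /mapP[t _ ->]]|om].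
  by rewrite mem_iota size_tuple.
exists (size o); first by rewrite mem_iota.
by apply/mapP; exists (in_tuple o); rewrite ?mem_enum.
Qed.

(** Lets sums over the words of different maximal lengths be compared inside
    one common index set. *)
Lemma sum_short_words (V : nmodType) (S : {fset word n r}) m
    (P : pred (word n r)) (u : word n r -> V) : (short_words m `<=` S)%fset ->
  \sum_(o <- S | P o && (size o <= m)%N) u o =
  \sum_(o <- short_words m | P o) u o.
Proof.
move=> /fsubsetP mS; rewrite -[LHS]big_filter -[RHS]big_filter; apply: perm_big.
apply: uniq_perm => [||o]; [exact/filter_uniq/fset_uniq..|].
rewrite !mem_filter -mem_short_words -andbA; congr (_ && _).
by case: (boolP (_ \in _)) => // /mS ->.
Qed.

End Words.

Section WordValues.
Context {R : realType} {k : scalar_kind} {g : vectType (scalars R k)}.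
Context {br : g -> g -> g} {n r : nat}.
Hypothesis hbr : is_lie_bracket br.
Implicit Types (x y : {ffun 'I_n -> g}) (w : {ffun 'I_r -> g}).
Implicit Types o : word n r.

Lemma word_val_cons x w a o : o != [::] ->
  word_val br x w (a :: o) = br (letter_val x w a) (word_val br x w o).
Proof. by case: o. Qed.

Lemma word_val_lcs x w o : word_val br x w o \in lcs br (size o).
Proof.
elim: o => [|a [|b o] IHo]; rewrite ?mem0v ?memvf//.
by rewrite word_val_cons// lcs_brr.
Qed.

Lemma word_val0 w o : state_word o -> word_val br 0 w o = 0.
Proof.
elim: o => [|a [|b o] IHo] //.
  by case: a => // a _; rewrite /= ffunE.
rewrite word_val_cons// /state_word; case: a => [a _|a ob].
  by rewrite /letter_val ffunE br0l.
by rewrite (IHo ob) br0r.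
Qed.

Lemma word_val_no_state x w o : ~~ state_word o ->
  word_val br x w o = word_val br 0 w o.
Proof.
elim: o => [|a [|b o] IHo] //; first by case: a.
rewrite (word_val_cons x)// (word_val_cons 0)// /state_word.
by case: a => // a ob; rewrite (IHo ob).
Qed.

(** A bracket with an element of a term of the lower central series falls into
    the next term, so a word of length at least 2 gains one step. *)
Lemma word_val_sub_lcs i x y w : (0 < i)%N ->
  (forall j, x j - y j \in lcs br i) ->
  forall o, word_val br x w o - word_val br y w o \in
    lcs br (i + (1 < size o)).
Proof.
move=> i0 xy; elim=> [|a [|b o] IHo].
- by rewrite subrr mem0v.
- by rewrite addn0; case: a => a /=; rewrite ?subrr ?mem0v.
- rewrite (word_val_cons x)// (word_val_cons y)// br_sub//= addn1 memvD//.
    by case: a => a /=; rewrite ?subrr ?br0l ?mem0v// lcs_br.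
  apply: lcs_brr => //; apply: subvP IHo.
  by rewrite lcs_antitone// leq_addr.
Qed.

Context {nrm : g -> R} {mu : R}.
Hypothesis hN : is_norm nrm.
Hypothesis mu0 : 0 <= mu.
Hypothesis br_bound : forall u v, nrm (br u v) <= mu * nrm u * nrm v.

Lemma word_val_norm x w (L : R) o : 0 <= L ->
  (forall a, nrm (letter_val x w a) <= L) -> o != [::] ->
  nrm (word_val br x w o) <= (mu * L) ^+ (size o).-1 * L.
Proof.
move=> L0 xwL; elim: o => [|a [|b o] IHo] // _; first by rewrite mul1r xwL.
rewrite word_val_cons// (le_trans (br_bound _ _))// exprS -[leRHS]mulrA.
by apply: ler_pM; rewrite ?mulr_ge0 ?nrm_ge0 ?ler_wpM2l//; exact: IHo.
Qed.

(** One state letter keeps its own bound e; the other letters are bounded by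
    the common bound L. *)
Lemma state_word_val_norm x w (L e : R) o : 0 <= L ->
  (forall a, nrm (letter_val x w a) <= L) -> (forall i, nrm (x i) <= e) ->
  state_word o -> nrm (word_val br x w o) <= (mu * L) ^+ (size o).-1 * e.
Proof.
move=> L0 xwL xe; elim: o => [|a [|b o] IHo] //.
  by case: a => // a _; rewrite mul1r xe.
rewrite word_val_cons// => ao.
apply: le_trans (br_bound _ _) _.
case: a ao => [a _|a /IHo{}IHo].
  have e0 : 0 <= e := le_trans (nrm_ge0 hN _) (xe a).
  have ? := @word_val_norm _ _ _ (b :: o) L0 xwL isT.
  rewrite -!mulrA mulrCA mulrC.
  apply: (@le_trans _ _ (mu * ((mu * L) ^+ size o * L) * e)).
    by apply: ler_pM; rewrite ?mulr_ge0 ?nrm_ge0 ?ler_wpM2l//; exact: xe.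
  by rewrite exprS le_eqVlt; apply/orP; left; apply/eqP; ring.
rewrite exprS -[leRHS]mulrA; apply: ler_pM; rewrite ?mulr_ge0 ?nrm_ge0//.
by rewrite ler_wpM2l//; exact: (xwL (inr a)).
Qed.

End WordValues.

(** * Expansion of the dynamics in mixed words *)

Section WordSeries.
Context {R : realType} {k : scalar_kind} {g : vectType (scalars R k)}.
Context {br : g -> g -> g} {nrm : g -> R} {n r p : nat}.
Hypothesis hbr : is_lie_bracket br.
Hypothesis hN : is_norm nrm.
Implicit Types (x y : {ffun 'I_n -> g}) (w : {ffun 'I_r -> g}).
Implicit Types c : word n r -> 'I_n -> scalars R k.

(** The partial sums over finite sets containing all short words are constant,
    so the unconditional limit is that constant. *)
Lemma word_sum_finite (u : word n r -> g) (l : g) :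
  (forall o, (p < size o)%N -> u o = 0) -> word_sum nrm u l ->
  l = \sum_(o <- short_words p | series_word o) u o.
Proof.
move=> u0 ul; apply/eqP; rewrite -subr_eq0; apply/eqP/(norm_definite hN).
apply/eqP; rewrite eq_le nrm_ge0// andbT leNgt; apply/negP => /[dup] lpos /ul.
case=> S0 /(_ (S0 `|` short_words p)%fset)/(_ (fsubsetUl _ _)).
rewrite (_ : \sum_(o <- _ | _) u o =
             \sum_(o <- short_words p | series_word o) u o).
  by rewrite ltxx.
rewrite (bigID (fun o => size o <= p)%N)/= addrC big1 ?add0r; last first.
  by move=> o /andP[_]; rewrite -ltnNge => /u0.
by rewrite sum_short_words// fsubsetUr.
Qed.

Definition mixed_part c (m : nat) x w : {ffun 'I_n -> g} :=
  [ffun i =>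
     \sum_(o <- short_words m | mixed_word o) c o i *: word_val br x w o].

Lemma series_word_mixed (o : word n r) :
  series_word o && state_word o = mixed_word o.
Proof. by case: o => [|[a|a] [|b o]]. Qed.

(** Subtracting the expansion of f 0 w = 0 cancels the words without a state
    letter, whose value does not depend on the state. *)
Lemma lie_function_expansion f (A : 'End({ffun 'I_n -> g})) c :
  lcs br p.+1 = 0%VS -> lie_function br nrm f A c -> (forall w, f 0 w = 0) ->
  forall x w, f x w = A x + mixed_part c p x w.
Proof.
move=> nilp fA f0 x w; apply/ffunP => i; rewrite !ffunE.
have fE y : f y w i - A y i =
    \sum_(o <- short_words p | series_word o) c o i *: word_val br y w o.
  apply: word_sum_finite (fA y w i) => o po; apply/eqP.
  rewrite scaler_eq0 -memv0 -nilp; apply/orP; right.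
  by apply: subvP (word_val_lcs _ _ _ _) => //; exact: lcs_antitone.
have := fE 0; rewrite f0 linear0 !ffunE subr0 => f00.
apply/eqP; rewrite addrC -subr_eq fE -[X in X == _]subr0 [X in _ - X]f00 -sumrB.
rewrite (bigID (@state_word n r))/= [X in _ + X]big1 ?addr0; last first.
  by move=> o /andP[_ /word_val_no_state->]; rewrite subrr.
apply/eqP; rewrite (eq_bigl (fun o => series_word o && state_word o))//.
apply: eq_big => [o|o /andP[_ so]]; first exact: series_word_mixed.
by rewrite word_val0// scaler0 subr0.
Qed.

(** Replacing x by an approximation y modulo the term i, and dropping the words
    longer than m >= i, costs only elements of the term i+1: the words of
    length at most m are compared letter by letter, and a dropped word has
    length at least i+1. *)
Lemma mixed_part_sub_lcs c m i x y w : (0 < i)%N -> (i <= m <= p)%N ->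
  (forall j, x j - y j \in lcs br i) ->
  forall j, mixed_part c p x w j - mixed_part c m y w j \in lcs br i.+1.
Proof.
move=> i0 /andP[im mp] xy j; rewrite !ffunE.
rewrite -(@sum_short_words _ _ _ (short_words p) m); last first.
  by apply/fsubsetP => o; rewrite !mem_short_words => /leq_trans; apply.
rewrite [X in _ - X]big_mkcondr -sumrB.
apply: memv_suml => o /andP[o1 _]; case: leqP => om.
  have := word_val_sub_lcs hbr w i0 xy o; rewrite o1 addn1 => xyo.
  by rewrite -scalerBr memvZ.
rewrite subr0 memvZ//; apply: subvP (word_val_lcs hbr _ _ _).
by apply: lcs_antitone => //; exact: leq_ltn_trans om.
Qed.

(** A = f - N, and N maps tuples of elements of the term i to such tuples, since
    its value is that of a difference of words at x and at 0. *)
Lemma linear_part_lcs f (A : 'End({ffun 'I_n -> g})) c i :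
  (forall x w, f x w = A x + mixed_part c p x w) ->
  (forall x w, (forall j, x j \in lcs br i) ->
     forall j, f x w j \in lcs br i) ->
  (0 < i)%N ->
  forall x, (forall j, x j \in lcs br i) -> forall j, A x j \in lcs br i.
Proof.
move=> fE flcs i0 x xi j; have := flcs x 0 xi j.
rewrite fE ffunE rpredDr// ffunE; apply: memv_suml => o /andP[_ so].
rewrite memvZ// -[word_val _ _ _ _]subr0 -(word_val0 hbr 0 so).
apply: subvP (word_val_sub_lcs hbr _ i0 _ _).
  by rewrite lcs_antitone// leq_addr.
by move=> l; rewrite ffunE subr0.
Qed.

Context {mu : R}.
Hypothesis mu0 : 0 <= mu.
Hypothesis br_bound : forall u v, nrm (br u v) <= mu * nrm u * nrm v.

Lemma nrm_le_sum_norm m (x : {ffun 'I_m -> g}) i : nrm (x i) <= sum_norm nrm x.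
Proof.
by rewrite /sum_norm (bigD1 i)//= lerDl sumr_ge0// => j _; rewrite nrm_ge0.
Qed.

(** S stands for s^t: a word of length at most m has at most m - 1 letters
    besides the distinguished state letter, which produces S^(m-1). *)
Lemma mixed_part_norm c m (D : R) : 0 <= D ->
  exists2 E, 0 <= E & forall x w (S e : R), 1 <= S ->
    sum_norm nrm x <= e -> e <= D * S -> sum_norm nrm w <= D * S ->
    sum_norm nrm (mixed_part c m x w) <= E * S ^+ m.-1 * e.
Proof.
move=> D0; pose E i := \sum_(o <- short_words m | mixed_word o)
  modulus (c o i) * (mu * D) ^+ (size o).-1.
exists (\sum_i E i) => [|x w S e S1 xe eDS wDS].
  do 2![apply: sumr_ge0 => ? _].
  by rewrite mulr_ge0 ?modulus_ge0// exprn_ge0// mulr_ge0.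
have S0 : 0 <= S := le_trans ler01 S1.
have e0 : 0 <= e.
  exact: le_trans (nrm_ge0 (sum_norm_is_norm hN n) x) xe.
have letterL a : nrm (letter_val x w a) <= D * S.
  case: a => a; first exact: le_trans (nrm_le_sum_norm _ _) (le_trans xe eDS).
  exact: le_trans (nrm_le_sum_norm _ _) wDS.
have xi i : nrm (x i) <= e := le_trans (nrm_le_sum_norm _ _) xe.
rewrite /sum_norm -mulrA mulr_suml; apply: ler_sum => i _; rewrite ffunE.
apply: le_trans (nrm_sum hN _ _ _) _; rewrite mulr_suml.
rewrite big_seq_cond [leRHS]big_seq_cond; apply: ler_sum => o /and3P[om _ so].
rewrite (norm_scale hN) -mulrA ler_wpM2l ?modulus_ge0//.
apply: le_trans (state_word_val_norm hN mu0 br_bound (mulr_ge0 D0 S0)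
  letterL xi so) _.
rewrite mulrA ler_wpM2r// mulrA exprMn ler_wpM2l ?exprn_ge0 ?mulr_ge0//.
by rewrite ler_weXn2l// -!subn1 leq_sub2r// -mem_short_words.
Qed.

End WordSeries.

Arguments mixed_part {R k g} br {n r} c m x w.

(** * Growth of the Picard iterates *)

Section Picard.
Context {R : realType} {k : scalar_kind} {g : vectType (scalars R k)}.
Context {br : g -> g -> g} {nrm : g -> R} {mu : R} {p n r : nat}.
Context {A : 'End({ffun 'I_n -> g})} {c : word n r -> 'I_n -> scalars R k}.
Context {W : nat -> {ffun 'I_r -> g}} {beta s lambda : R}.
Hypothesis hbr : is_lie_bracket br.
Hypothesis hN : is_norm nrm.
Hypothesis mu0 : 0 <= mu.
Hypothesis br_bound : forall u v, nrm (br u v) <= mu * nrm u * nrm v.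
Hypothesis A_lcs : forall i, (0 < i)%N ->
  forall x : {ffun 'I_n -> g}, (forall j, x j \in lcs br i) ->
    forall j, A x j \in lcs br i.
Hypothesis beta0 : 0 <= beta.
Hypothesis s1 : 1 <= s.
Hypothesis W_growth : forall t, sum_norm nrm (W t) <= beta * s ^+ t.
Hypothesis lambda0 : 0 <= lambda.
Hypothesis rhoA : spectral_radius A < lambda.
Hypothesis lambda_small : lambda * s ^+ 'C(p, 2) <= 1.

(** The exponent is the sum 0 + 1 + ... + (i-1) of the exponents gained in the
    successive iterations. *)
Definition picard_rate i : R := lambda * s ^+ 'C(i, 2).

(** The iterate number i is exhibited together with its two properties: it is
    exact modulo the term i+1, and it has rate picard_rate i, with a constant
    that depends only on the bound M on the initial state. *)
Lemma picard_approximation (M : R) i : 0 <= M -> (i <= p)%N ->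
  exists2 K, 0 <= K & forall x : nat -> {ffun 'I_n -> g},
    (forall t, x t.+1 = A (x t) + mixed_part br c p (x t) (W t)) ->
    sum_norm nrm (x 0%N) <= M ->
    exists2 y : nat -> {ffun 'I_n -> g},
      forall t j, x t j - y t j \in lcs br i.+1 &
      forall t,
        sum_norm nrm (y t) <= K * picard_rate i ^+ t * sum_norm nrm (x 0%N).
Proof.
have hX := sum_norm_is_norm hN n.
have s0 : 0 <= s := le_trans ler01 s1.
have rate0 j : 0 <= picard_rate j by rewrite mulr_ge0// exprn_ge0.
move=> M0; elim: i => [_|i IHi ip].
  exists 0 => // x _ _; exists (fun=> 0) => [t j|t]; first by rewrite memvf.
  by rewrite nrm0// !mul0r.
have [K K0 KP] := IHi (ltnW ip).
have rate1 : picard_rate i <= 1.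
  apply: le_trans lambda_small; rewrite ler_wpM2l// ler_weXn2l//.
  by rewrite leq_bin2l// ltnW.
have rate_lambda : lambda <= picard_rate i.+1.
  by rewrite ler_peMr// exprn_ege1.
(* K * M bounds the iterate i, whose rate is at most 1, and beta bounds W. *)
have [E E0 EP] := @mixed_part_norm _ _ _ br nrm n r hN mu mu0 br_bound c i.+1
  (K * M + beta) (addr_ge0 (mulr_ge0 K0 M0) beta0).
have [L L0 LP] := @forced_linear_recursion _ _ _ _ A (picard_rate i.+1) hX
  (rate0 _) (lt_le_trans rhoA rate_lambda).
exists (L * (1 + E * K)) => [|x xS xM].
  by rewrite mulr_ge0// addr_ge0// mulr_ge0.
have [y xy yK] := KP x xS xM.
pose h t := mixed_part br c i.+1 (y t) (W t).
pose z t : {ffun 'I_n -> g} := iteri t (fun t v => A v + h t) (x 0%N).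
have x00 : 0 <= sum_norm nrm (x 0%N) by exact: nrm_ge0.
have st1 t : 1 <= s ^+ t by exact: exprn_ege1.
exists z => [|t].
  elim=> [|t IHt] j; first by rewrite subrr mem0v.
  have ffD (u v : {ffun 'I_n -> g}) : (u + v) j = u j + v j by rewrite ffunE.
  rewrite xS /z/= -/(z t) !ffD opprD addrACA memvD//.
    have xz l : (x t - z t) l \in lcs br i.+2 by rewrite !ffunE.
    by have := @A_lcs i.+2 isT _ xz j; rewrite linearB !ffunE.
  by apply: mixed_part_sub_lcs => //; rewrite ip leqnn.
have -> : L * (1 + E * K) * picard_rate i.+1 ^+ t * sum_norm nrm (x 0%N) =
    L * (sum_norm nrm (z 0%N) + E * K * sum_norm nrm (x 0%N)) *
    picard_rate i.+1 ^+ t.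
  by rewrite /z/=; ring.
apply: (LP z h) => // {}t.
have Kst : K * picard_rate i ^+ t * sum_norm nrm (x 0%N) <=
    (K * M + beta) * s ^+ t.
  apply: (@le_trans _ _ (K * M)).
    rewrite -mulrA ler_wpM2l//; apply: le_trans xM.
    by rewrite ler_piMl// exprn_ile1.
  apply: (@le_trans _ _ (K * M + beta)); first by rewrite lerDl.
  by rewrite ler_peMr// addr_ge0// mulr_ge0.
have Wst : sum_norm nrm (W t) <= (K * M + beta) * s ^+ t.
  by rewrite (le_trans (W_growth t))// ler_wpM2r ?exprn_ge0// lerDr mulr_ge0.
apply: le_trans (EP _ _ _ _ (st1 t) (yK t) Kst Wst) _.
rewrite le_eqVlt; apply/orP; left; apply/eqP => /=.
have -> : picard_rate i.+1 ^+ t = picard_rate i ^+ t * (s ^+ t) ^+ i.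
  rewrite exprAC -exprMn; congr (_ ^+ t).
  by rewrite /picard_rate binS bin1 exprD mulrA.
by ring.
Qed.

End Picard.

(** * Semiglobal exponential stability *)

Theorem theorem4p2 (R : realType) (k : scalar_kind)
    (g : vectType (scalars R k)) (br : g -> g -> g) (nrm : g -> R) (mu : R)
    (p n r : nat)
    (f : {ffun 'I_n -> g} -> {ffun 'I_r -> g} -> {ffun 'I_n -> g})
    (A : 'End({ffun 'I_n -> g})) (c : word n r -> 'I_n -> scalars R k)
    (W : nat -> {ffun 'I_r -> g}) (beta s : R) :
  is_lie_bracket br ->
  is_norm nrm ->
  0 <= mu <= 2 ->
  (forall x y, nrm (br x y) <= mu * nrm x * nrm y) ->
  has_nilindex br p ->
  (0 < n)%N -> (0 < r)%N ->
  lie_function br nrm f A c ->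
  class_A nrm mu c ->
  (forall x, (forall w, f x w = x) <-> x = 0) ->
  (forall i, (0 < i)%N -> forall (x : {ffun 'I_n -> g}) w,
     (forall j, x j \in lcs br i) -> forall j, f x w j \in lcs br i) ->
  0 <= beta -> 1 <= s ->
  (forall t, sum_norm nrm (W t) <= beta * s ^+ t) ->
  spectral_radius A < s `^ (p%:R * (1 - p%:R) / 2) ->
  semiglobally_exp_stable (sum_norm nrm) (fun t x => f x (W t)).
Proof.
move=> hbr hN /andP[mu0 _] br_bound [nilp _] _ _ fA _ f_eq f_lcs beta0 s1.
move=> W_growth.
have s0 : 0 < s := lt_le_trans ltr01 s1.
have binR q : 'C(q, 2)%:R = q%:R * (q%:R - 1) / 2 :> R.
  elim: q => [|q IHq]; first by rewrite mul0r mul0r.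
  by rewrite binS bin1 natrD IHq -natr1; field.
have -> : s `^ (p%:R * (1 - p%:R) / 2) = (s ^+ 'C(p, 2))^-1.
  by rewrite -powR_mulrn ?(ltW s0)// -powRN binR; congr powR; field.
move=> rhoA M M0; have sp0 : 0 < s ^+ 'C(p, 2) by exact: exprn_gt0.
have [lambda lambda0 /andP[rho_lambda lambda_lt]] : exists2 lambda,
    0 <= lambda & spectral_radius A < lambda < (s ^+ 'C(p, 2))^-1.
  have : Num.max 0 (spectral_radius A) < (s ^+ 'C(p, 2))^-1.
    by rewrite gt_max invr_gt0 sp0.
  move=> /midf_lt[lo hi]; move: lo; rewrite gt_max => /andP[lo0 lo].
  by exists ((Num.max 0 (spectral_radius A) + (s ^+ 'C(p, 2))^-1) / 2);
    rewrite ?ltW// lo.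
have lambda_s : lambda * s ^+ 'C(p, 2) < 1 by rewrite -ltr_pdivlMr// div1r.
have fE := lie_function_expansion hbr hN nilp fA (fun w => (f_eq 0).2 erefl w).
have A_lcs i (i0 : (0 < i)%N) := linear_part_lcs hbr fE (f_lcs i i0) i0.
have [K K0 KP] := picard_approximation (c := c) hbr hN mu0 br_bound A_lcs
  beta0 s1 W_growth lambda0 rho_lambda (ltW lambda_s) (ltW M0) (leqnn p).
exists K, (lambda * s ^+ 'C(p, 2)); split=> // x xS xM t.
have [|y xy yK] := KP x _ xM; first by move=> u; rewrite xS fE.
suff -> : x t = y t by exact: yK.
apply/ffunP => j; apply/eqP; rewrite -subr_eq0 -memv0 -nilp; exact: xy.
Qed.
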